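(* Let $\mathcal{S}$ denote the class of all graphs having the strong Havel--Hakimi property. Then $$\mathcal{S} = \operatorname{Forb}(\{P_5,\ \text{4-pan},\ K_{2,3},\ K_{2,3}^+,\ \text{kite},\ 2P_3,\ P_3+K_3,\ \text{stool},\ \text{co-domino}\}).$$ That is, a graph $G$ has the strong Havel--Hakimi property if and only if no induced subgraph of $G$ is isomorphic to one of these nine graphs.
   Context: All graphs are finite and simple. A vertex $v$ of a graph $G$ has the Havel--Hakimi property (in $G$) if $v$ has maximum degree in $G$ and no vertex adjacent to $v$ has degree smaller than that of some vertex not adjacent to $v$; that is, $d_G(w)\ge d_G(u)$ for every neighbor $w$ of $v$ and every vertex $u\neq v$ not adjacent to $v$. A graph $G$ has the strong Havel--Hakimi property if in every induced subgraph $H$ of $G$, every vertex of maximum degree in $H$ has the Havel--Hakimi property in $H$. For a class $\mathcal{F}$ of graphs, $\operatorname{Forb}(\mathcal{F})$ is the class of all graphs having no induced subgraph isomorphic to an element of $\mathcal{F}$. Notation for graphs: $G+H$ is the disjoint union of $G$ and $H$, and $mG$ is the disjoint union of $m$ copies of $G$. $P_n$ is the path on $n$ vertices, $K_n$ the complete graph on $n$ vertices, and $K_{m,n}$ the complete bipartite graph with partite sets of sizes $m$ and $n$. $K_{2,3}^+$ is the graph obtained from $K_{2,3}$ by adding one edge joining two vertices of the partite set of size 3 (equivalently, the complement of $K_2+P_3$). The remaining graphs are: - 4-pan: 5 vertices; a 4-cycle together with one further vertex adjacent to exactly one vertex of the cycle. - kite: 5 vertices; the graph obtained from $K_4$ minus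 an edge by adding one new vertex adjacent to exactly one of the two vertices of degree 2. Explicitly, vertices $a,b,c,p,d$ and edges $ab, bc, pa, pb, pc, cd$. - stool: 6 vertices $u,x,y,v,w,z$ and edges $ux, uy, xy, xv, vw, vz$ (a triangle $uxy$, with $x$ joined to a vertex $v$ that has two pendant neighbors $w,z$). - co-domino: 6 vertices $u,x,y,v,w,z$ and edges $ux, uy, xy, vw, vz, wz, xv, yz$ (two disjoint triangles joined by two disjoint edges; the complement of the graph obtained from a 6-cycle by adding a chord joining two opposite vertices). *)

(* Defs.v *)
From mathcomp Require Import all_boot.

Set Implicit Arguments.
Unset Strict Implicit.
Unset Printing Implicit Defensive.

Record sgraph := SGraph {
  vertex :> finType;
  adj : rel vertex;
  adj_sym : symmetric adj;
  adj_irrefl : irreflexive adj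
}.

Definition deg (G : sgraph) (v : G) : nat := #|[set w | adj v w]|.

Definition max_degree (G : sgraph) (v : G) : Prop :=
  forall u : G, deg u <= deg v.

Definition HH_property (G : sgraph) (v : G) : Prop :=
  max_degree v /\
  forall w u : G, adj v w -> u != v -> ~~ adj v u -> deg u <= deg w.

Section Induced.
Variables (G : sgraph) (A : {set G}).

Definition induced_adj : rel {x : G | x \in A} :=
  fun x y => adj (val x) (val y).

Fact induced_sym : symmetric induced_adj.
Proof. by move=> x y; apply: adj_sym. Qed.

Fact induced_irrefl : irreflexive induced_adj.
Proof. by move=> x; apply: adj_irrefl. Qed.

Definition induced : sgraph := SGraph induced_sym induced_irrefl.
End Induced.

Definition strong_HH (G : sgraph) : Prop :=
  forall (A : {set G}) (v : induced A), max_degree v -> HH_property v.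

Definition isomorphic (G H : sgraph) : Prop :=
  exists2 f : G -> H, bijective f & forall x y, adj (f x) (f y) = adj x y.

Definition Forb (F : sgraph -> Prop) (G : sgraph) : Prop :=
  forall H : sgraph, F H -> forall A : {set G}, ~ isomorphic (induced A) H.

(* graph_of r forgets the loops and the orientation of r, so the relations
   below only need to list each edge in one direction. *)
Section GraphOf.
Variables (T : finType) (r : rel T).

Definition graph_of_adj : rel T := fun x y => (x != y) && (r x y || r y x).

Fact graph_of_sym : symmetric graph_of_adj.
Proof. by move=> x y; rewrite /graph_of_adj eq_sym orbC. Qed.

Fact graph_of_irrefl : irreflexive graph_of_adj.
Proof. by move=> x; rewrite /graph_of_adj eqxx. Qed.

Definition graph_of : sgraph := SGraph graph_of_sym graph_of_irrefl.
End GraphOf.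

Definition path_graph (n : nat) : sgraph :=
  graph_of (fun i j : 'I_n => i.+1 == j).

Definition complete_graph (n : nat) : sgraph :=
  graph_of (fun _ _ : 'I_n => true).

Definition complete_bipartite (m n : nat) : sgraph :=
  graph_of (fun x y : 'I_m + 'I_n =>
    match x, y with inl _, inr _ => true | _, _ => false end).

Definition disjoint_union (G H : sgraph) : sgraph :=
  graph_of (fun x y : G + H =>
    match x, y with
    | inl a, inl b => adj a b
    | inr a, inr b => adj a b
    | _, _ => false
    end).

Definition copies (m : nat) (G : sgraph) : sgraph :=
  graph_of (fun x y : 'I_m * G => (x.1 == y.1) && adj x.2 y.2).

Definition add_edge (G : sgraph) (a b : G) : sgraph :=
  graph_of (fun x y : G => adj x y || (x == a) && (y == b)).

Definition edge_graph (n : nat) (s : seq (nat * nat)) : sgraph :=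
  graph_of (fun i j : 'I_n => (val i, val j) \in s).

Definition P5 : sgraph := path_graph 5.

Definition pan4 : sgraph :=
  edge_graph 5 [:: (0, 1); (1, 2); (2, 3); (3, 0); (0, 4)].

Definition K23 : sgraph := complete_bipartite 2 3.

Definition K23_plus : sgraph :=
  @add_edge (complete_bipartite 2 3) (inr ord0) (inr ord_max).

(* a, b, c, p, d = 0, 1, 2, 3, 4: edges ab, bc, pa, pb, pc, cd. *)
Definition kite : sgraph :=
  edge_graph 5 [:: (0, 1); (1, 2); (3, 0); (3, 1); (3, 2); (2, 4)].

Definition twoP3 : sgraph := copies 2 (path_graph 3).

Definition P3_K3 : sgraph := disjoint_union (path_graph 3) (complete_graph 3).

(* u, x, y, v, w, z = 0, 1, 2, 3, 4, 5: edges ux, uy, xy, xv, vw, vz. *)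
Definition stool : sgraph :=
  edge_graph 6 [:: (0, 1); (0, 2); (1, 2); (1, 3); (3, 4); (3, 5)].

(* u, x, y, v, w, z = 0, 1, 2, 3, 4, 5:
   edges ux, uy, xy, vw, vz, wz, xv, yz. *)
Definition co_domino : sgraph :=
  edge_graph 6 [:: (0, 1); (0, 2); (1, 2); (3, 4); (3, 5); (4, 5);
                   (1, 3); (2, 5)].

Inductive forbidden_graphs : sgraph -> Prop :=
| Forb_P5 : forbidden_graphs P5
| Forb_pan4 : forbidden_graphs pan4
| Forb_K23 : forbidden_graphs K23
| Forb_K23_plus : forbidden_graphs K23_plus
| Forb_kite : forbidden_graphs kite
| Forb_twoP3 : forbidden_graphs twoP3
| Forb_P3_K3 : forbidden_graphs P3_K3
| Forb_stool : forbidden_graphs stool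
| Forb_co_domino : forbidden_graphs co_domino.

(* Main.v *)
Require Import Defs.
From mathcomp Require Import all_boot.

(** If the Havel-Hakimi property fails at v, some w adjacent to v and u not
    adjacent to v satisfy deg w < deg u, while deg x <= deg v for every x. Hence
    deg w + deg x < deg u + deg v for every x. Whenever the subgraph induced by
    a set s of vertices violates this inequality, some vertex y outside s has
    more neighbours (with multiplicity) in the pair u, v than in the pair w, x,
    and s can be enlarged by y. Starting from s = {v, w, u} and choosing x well,
    every branch of this process reaches a forbidden induced subgraph on at most
    seven vertices; the finite case analysis is done by computation. *)

Set Implicit Arguments.
Unset Strict Implicit.
Unset Printing Implicit Defensive.

(** * Embeddings, and transport of the property along isomorphisms *)

Definition embedding (H G : sgraph) (f : H -> G) : Prop :=
  injective f /\ forall x y, adj (f x) (f y) = adj x y.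

Lemma embedding_comp (H G K : sgraph) (f : H -> G) (g : G -> K) :
  embedding f -> embedding g -> embedding (g \o f).
Proof.
move=> [fI fa] [gI ga]; split; first exact: inj_comp.
by move=> x y /=; rewrite ga fa.
Qed.

Lemma embedding_induced (G : sgraph) (A : {set G}) :
  @embedding (induced A) G val.
Proof. by split=> //; apply: val_inj. Qed.

Lemma embedding_isomorphic (H G : sgraph) (f : H -> G) :
  embedding f -> exists A : {set G}, isomorphic (induced A) H.
Proof.
case=> fI fa; exists [set y in codom f].
have fP x : f x \in [set y in codom f] by rewrite inE codom_f.
have gP (y : induced [set y in codom f]) : val y \in codom f.
  by have := valP y; rewrite inE.
exists (fun y => iinv (gP y)).
  exists (fun x => exist _ (f x) (fP x) : induced _) => [y|x].
    by apply: val_inj; rewrite /= f_iinv.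
  by apply: fI; rewrite f_iinv.
by move=> x y; rewrite -fa !f_iinv.
Qed.

Lemma deg_isomorphic (G H : sgraph) (f : G -> H) (x : G) :
  bijective f -> (forall x y, adj (f x) (f y) = adj x y) ->
  deg (f x) = deg x.
Proof.
move=> [g fK gK] fa; rewrite /deg -(card_imset _ (can_inj fK)).
congr #|pred_of_set _|; apply/setP=> y; rewrite inE -[y]gK fa.
by rewrite mem_imset ?inE //; apply: can_inj fK.
Qed.

Lemma isomorphic_sym (G H : sgraph) : isomorphic G H -> isomorphic H G.
Proof.
case=> f [g fK gK] fa; exists g; first by exists f.
by move=> x y; rewrite -fa !gK.
Qed.

Lemma strong_HH_isomorphic (G H : sgraph) (A : {set G}) (v : H) :
  strong_HH G -> isomorphic (induced A) H -> max_degree v -> HH_property v.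
Proof.
move=> sG /isomorphic_sym[g gB ga] vmax; have degg x := deg_isomorphic x gB ga.
have [f fK gK] := gB.
have gvmax : max_degree (g v) by move=> u; rewrite -[u]gK !degg.
split=> // w u vw uv vu; have [_ /(_ (g w) (g u))] := sG _ _ gvmax.
by rewrite !degg !ga (can_eq fK); apply.
Qed.

(** * The nine forbidden graphs as explicit vertex lists *)

Lemma deg_count (H : sgraph) (l : seq H) (x : H) :
  uniq l -> (forall y, y \in l) -> deg x = count (adj x) l.
Proof.
move=> lU lT; rewrite /deg -size_filter -(card_uniqP (filter_uniq _ lU)).
by apply: eq_card => y; rewrite inE mem_filter lT andbT.
Qed.

(** Degrees are counted along an enumeration [l] of the vertices, so that failure of the property is
    decided by evaluation. *)
Definition HH_violated (H : sgraph) (l : seq H) : bool :=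
  let d x := count (adj x) l in
  has (fun v => all (fun x => d x <= d v) l &&
    has (fun w => adj v w &&
      has (fun u => [&& u != v, ~~ adj v u & d w < d u]) l) l) l.

Lemma HH_violatedP (H : sgraph) (l : seq H) :
  uniq l -> (forall y, y \in l) -> HH_violated l ->
  exists2 v : H, max_degree v & ~ HH_property v.
Proof.
move=> lU lT /hasP[v _ /andP[/allP vmax /hasP[w _]]].
case/andP=> vw /hasP[u _ /and3P[uv vu]].
rewrite -!deg_count // ltnNge => /negP wu; exists v.
  by move=> x; rewrite !(deg_count _ lU lT); apply: vmax.
by case=> _ /(_ w u vw uv vu).
Qed.

(* Unlike [enum 'I_n], this list reduces by computation. *)
Fixpoint ords (n : nat) : seq 'I_n :=
  if n is m.+1 then ord0 :: map (lift ord0) (ords m) else [::].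

(** Each forbidden graph is paired with a vertex list that reduces by computation. The default [P5]
    keeps [obstruction i] forbidden at every index. *)
Definition obstruction (i : nat) : {H : sgraph & seq H} :=
  nth (existT (fun H : sgraph => seq H) P5 (ords 5))
  [:: existT (fun H : sgraph => seq H) P5 (ords 5);
      existT (fun H : sgraph => seq H) pan4 (ords 5);
      existT (fun H : sgraph => seq H) K23
        (map inl (ords 2) ++ map inr (ords 3));
      existT (fun H : sgraph => seq H) K23_plus
        (map inl (ords 2) ++ map inr (ords 3));
      existT (fun H : sgraph => seq H) kite (ords 5);
      existT (fun H : sgraph => seq H) twoP3
        [seq (i, j) | i <- ords 2, j <- ords 3];
      existT (fun H : sgraph => seq H) P3_K3
        (map inl (ords 3) ++ map inr (ords 3));
      existT (fun H : sgraph => seq H) stool (ords 6);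
      existT (fun H : sgraph => seq H) co_domino (ords 6)] i.

Lemma forbidden_obstruction (i : nat) : forbidden_graphs (tag (obstruction i)).
Proof. by do 9?[case: i => [|i]; first by constructor]; case: i; constructor. Qed.

Lemma obstruction_forbidden (H : sgraph) :
  forbidden_graphs H -> exists2 i, i < 9 & tag (obstruction i) = H.
Proof.
by case; [exists 0 | exists 1 | exists 2 | exists 3 | exists 4 | exists 5
         | exists 6 | exists 7 | exists 8].
Qed.

Lemma obstruction_uniq (i : nat) : uniq (tagged (obstruction i)).
Proof.
by do 9?[case: i => [|i]; first by vm_compute]; case: i; vm_compute.
Qed.

Lemma mem_ords (n : nat) (i : 'I_n) : i \in ords n.
Proof.
elim: n i => [[]//|n IHn] i; rewrite inE /=.
by case: (unliftP ord0 i) => [j|] ->; rewrite ?eqxx // map_f ?orbT.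
Qed.

Lemma mem_ords_sum (m n : nat) (x : 'I_m + 'I_n) :
  x \in map inl (ords m) ++ map inr (ords n).
Proof. by rewrite mem_cat; case: x => i; rewrite map_f ?orbT ?mem_ords. Qed.

Lemma mem_ords_prod (m n : nat) (x : 'I_m * 'I_n) :
  x \in [seq (i, j) | i <- ords m, j <- ords n].
Proof. by case: x => i j; apply: allpairs_f; apply: mem_ords. Qed.

Lemma mem_obstruction (i : nat) (x : tag (obstruction i)) :
  x \in tagged (obstruction i).
Proof.
by move: x; do 9?[case: i => [|i];
     first by [apply: mem_ords | apply: mem_ords_sum | apply: mem_ords_prod]];
   case: i => [|i] x; apply: (mem_ords (n := 5)).
Qed.

Lemma obstruction_HH_violated (i : nat) : i < 9 ->
  HH_violated (tagged (obstruction i)).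
Proof. by do 9?[case: i => [|i]; first by vm_compute]. Qed.

(** * Search on labelled graphs *)

(* Adds the vertex n to a graph on 0, ..., n - 1; r lists its adjacencies. *)
Definition extend (n : nat) (M : rel nat) (r : seq bool) : rel nat :=
  fun i j => if i == n then nth false r j
             else if j == n then nth false r i else M i j.

Fixpoint all_bits (n : nat) (p : pred (seq bool)) : bool :=
  if n is m.+1 then
    all_bits m (fun r => p (true :: r)) && all_bits m (fun r => p (false :: r))
  else p [::].

Lemma all_bitsP (n : nat) (p : pred (seq bool)) (r : seq bool) :
  all_bits n p -> size r = n -> p r.
Proof.
elim: n p r => [|n IHn] p [|b r] //= /andP[pt pf] [sr].
by case: b; [apply: (IHn (fun r => p (true :: r)))
           | apply: (IHn (fun r => p (false :: r)))].
Qed.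

(* [embeds] matches the vertices of H one by one with labels below n, comparing
   adjacencies to the vertices already matched ([done]). *)
Section Embeds.
Variables (H : sgraph) (n : nat) (M : rel nat).

Fixpoint adj_rows (todo done : seq H) : seq (seq bool) :=
  if todo is a :: todo' then map (adj a) done :: adj_rows todo' (a :: done)
  else [::].

Fixpoint embeds (rows : seq (seq bool)) (done : seq nat) : bool :=
  if rows is r :: rows' then
    has (fun j => embeds rows' (j :: done))
        [seq j <- iota 0 n | if j \in done then false else map (M j) done == r]
  else true.

Definition partial_embedding (l : seq H) (g : H -> nat) : Prop :=
  {in l, forall x, g x < n} /\
  {in l &, forall x y, x != y -> g x != g y /\ M (g x) (g y) = adj x y}.

Hypothesis M_sym : symmetric M.

Lemma embedsP (todo done : seq H) (g : H -> nat) :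
  uniq (catrev todo done) -> partial_embedding done g ->
  embeds (adj_rows todo done) (map g done) ->
  exists g', partial_embedding (catrev todo done) g'.
Proof.
elim: todo done g => [|a todo IH] done g /=; first by exists g.
move=> U [gn gM] /hasP[j]; rewrite mem_filter mem_iota add0n.
case: ifPn => // jD /andP[/eqP rowE jn].
have aD : a \notin done.
  by move: U; rewrite catrevE cat_uniq cons_uniq => /and3P[_ _ /andP[]].
have jP x : x \in done -> j != g x /\ M j (g x) = adj a x.
  move=> xD; split; first by apply: contraNneq jD => ->; apply: map_f.
  have /eq_in_map/(_ x xD) // : map (M j \o g) done = map (adj a) done.
  by rewrite map_comp.
pose g' := [eta g with a |-> j].
have g'E x : x \in done -> g' x = g x.
  by rewrite /g' /=; case: eqVneq => // -> /(negP aD).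
have g'a : g' a = j by rewrite /g' /= eqxx.
have -> : j :: map g done = map g' (a :: done).
  by rewrite map_cons g'a; congr cons; apply/eq_in_map=> x /g'E.
apply: (IH _ g') => //; split=> [x|x y]; rewrite !inE => /predU1P[->|xD].
- by rewrite g'a.
- by rewrite g'E //; apply: gn.
- by case/predU1P=> [->|yD _]; rewrite ?eqxx // g'a g'E //; apply: jP.
case/predU1P=> [-> _|yD]; last by rewrite !g'E //; apply: gM.
by rewrite g'a g'E // eq_sym M_sym adj_sym; apply: jP.
Qed.

End Embeds.

Definition has_obstruction (n : nat) (M : rel nat) : bool :=
  has (fun i => embeds n M (adj_rows (tagged (obstruction i)) [::]) [::])
      (iota 0 9).

(* Labels 0, 1 and 2 stand for v, w and u; [x] and the row [r] of the new vertex
   play the roles of x and y in the header. The test [find p s < size s] is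
   [has p s], but call-by-value evaluation stops it at the first success. *)
Fixpoint refutes (fuel n : nat) (M : rel nat) : bool :=
  if has_obstruction n M then true else
  if fuel is fuel'.+1 then
    let d i := count (M i) (iota 0 n) in
    let p x := if d 2 + d 0 <= d 1 + d x then
      all_bits n (fun r =>
        if nth false r 1 + nth false r x < nth false r 2 + nth false r 0
        then refutes fuel' n.+1 (extend n M r) else true)
      else false in
    find p (iota 0 n) < n
  else false.

(** The choice of v, w and u makes v-w an edge and v-u a non-edge; [e] is the adjacency of w and u,
    which is left open. *)
Definition seed (e : bool) : rel nat :=
  extend 2 (extend 1 (fun _ _ => false) [:: true]) [:: false; e].

(** Fuel 4 lets the search grow from three vertices to seven. *)
Lemma seed_refuted (e : bool) : refutes 4 3 (seed e).
Proof. by case: e; vm_compute. Qed.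

(** * Soundness of the search *)

Lemma extend_sym (n : nat) (M : rel nat) (r : seq bool) :
  symmetric M -> symmetric (extend n M r).
Proof.
move=> M_sym i j; rewrite /extend.
by have [->|_] := eqVneq i n; case: (eqVneq j n) => // ->.
Qed.

(** The label map found by [embeds], followed by [nth x0 s], is the embedding; [uniq s] makes it
    injective. *)
Lemma has_obstructionP (G : sgraph) (x0 : G) (s : seq G) (M : rel nat) :
  uniq s -> symmetric M ->
  {in gtn (size s) &, forall i j, M i j = adj (nth x0 s i) (nth x0 s j)} ->
  has_obstruction (size s) M ->
  exists H, forbidden_graphs H /\ exists f : H -> G, embedding f.
Proof.
move=> sU M_sym Ms /hasP[i _]; set l := tagged (obstruction i) => emb.
exists (tag (obstruction i)); split; first exact: forbidden_obstruction.
have lU : uniq (catrev l [::]) by rewrite catrevE cats0 rev_uniq obstruction_uniq.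
have no_label H : @partial_embedding H (size s) M [::] (fun=> 0) by [].
have [g [gn gM]] := embedsP M_sym lU (no_label _) emb.
have lT x : x \in catrev l [::] by rewrite catrevE cats0 mem_rev mem_obstruction.
exists (fun x => nth x0 s (g x)); split=> [x y /eqP|x y].
  rewrite nth_uniq ?gn //; apply: contraTeq => xy.
  by have [] := gM x y (lT x) (lT y) xy.
have [->|xy] := eqVneq x y; first by rewrite !adj_irrefl.
by rewrite -Ms ?inE ?gn //; have [] := gM x y (lT x) (lT y) xy.
Qed.

Lemma deg_split (G : sgraph) (s : seq G) (x : G) : uniq s ->
  deg x = count (adj x) s + \sum_(y | y \notin s) adj x y.
Proof.
move=> sU; rewrite /deg -sum1dep_card big_mkcond (bigID (mem s)) /=.
by rewrite -big_uniq // -sumn_count sumnE big_map.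
Qed.

(** Otherwise, summing the reverse inequality over all y outside [s] and adding the counts inside
    [s] gives deg u + deg v <= deg w + deg x. *)
Lemma compensating_vertex (G : sgraph) (s : seq G) (v w u x : G) : uniq s ->
  deg w + deg x < deg u + deg v ->
  count (adj u) s + count (adj v) s <= count (adj w) s + count (adj x) s ->
  exists2 y, y \notin s & adj y w + adj y x < adj y u + adj y v.
Proof.
move=> sU lt_deg le_count; case: (pickP [pred y | (y \notin s) &&
    (adj y w + adj y x < adj y u + adj y v)]) => [y /andP[]|none].
  by exists y.
have: \sum_(y | y \notin s) (adj u y + adj v y) <=
       \sum_(y | y \notin s) (adj w y + adj x y).
  apply: leq_sum => y ys; have := none y; rewrite /= ys /= ltnNge.
  by rewrite !(adj_sym y) => /negbFE.
rewrite !big_split /= => le_sum; move: lt_deg; rewrite !(deg_split _ sU) ltnNge.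
by rewrite addnACA [leqRHS]addnACA leq_add.
Qed.

(** Induction on [fuel], with the invariant that [M] records the adjacencies on [s]. The actual row
    of the compensating vertex is among those tested by [all_bits]. *)
Lemma refutesP (G : sgraph) (v w u : G) (fuel : nat) (t : seq G) (M : rel nat) :
  let s := [:: v, w, u & t] in
  max_degree v -> deg w < deg u -> uniq s -> symmetric M ->
  {in gtn (size s) &, forall i j, M i j = adj (nth v s i) (nth v s j)} ->
  refutes fuel (size s) M ->
  exists H, forbidden_graphs H /\ exists f : H -> G, embedding f.
Proof.
move=> s vmax wu; elim: fuel t @s M => [|fuel IH] t s M sU M_sym Ms;
  (* Naming the size keeps simplification from unfolding it to a successor. *)
  have [n nE] : exists n, n = size s by exists (size s).
  rewrite -nE /=; case: ifP => // obs _; rewrite nE in obs.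
  exact: has_obstructionP sU M_sym Ms obs.
rewrite -nE in Ms *; rewrite [refutes _ _ _]/=; case: ifP => [|_].
  by rewrite nE in Ms * => obs _; apply: has_obstructionP sU M_sym Ms obs.
rewrite -[X in _ < X](size_iota 0 n) -has_find => /hasP[x].
rewrite mem_iota /= add0n => xn; case: ifP => // le_count all_r.
have countE i : i < n -> count (M i) (iota 0 n) = count (adj (nth v s i)) s.
  move=> ltin; rewrite -[X in _ = count _ X](mkseq_nth v s) count_map -nE.
  by apply: eq_in_count => j; rewrite mem_iota /= => jn; rewrite Ms.
have [//||y ys gain] := @compensating_vertex G s v w u (nth v s x) sU.
- by rewrite -addSn leq_add.
- by move: le_count; rewrite !countE // nE.
pose r := map (adj y) s.
have rE i : i < n -> nth false r i = adj y (nth v s i).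
  by rewrite nE => lti; apply: nth_map.
have rn : size r = n by rewrite size_map nE.
have := all_bitsP all_r rn; rewrite ifT; last by rewrite !rE //; rewrite nE.
(* The new vertex goes at the end, so it gets label [n] and the old labels keep their meaning. *)
have -> : n.+1 = size [:: v, w, u & rcons t y] by rewrite nE /= size_rcons.
apply: IH => [||i j].
- by rewrite -[[:: v, w, u & _]]/(rcons s y) rcons_uniq ys.
- exact: extend_sym.
rewrite -[[:: v, w, u & _]]/(rcons s y) size_rcons -nE !inE !ltnS.
rewrite (leq_eqVlt i) (leq_eqVlt j) /extend !nth_rcons -nE.
case/predU1P=> [->|li]; case/predU1P=> [->|lj]; rewrite ?ltnn ?eqxx.
(* Reading [r] at [n], its length, gives the default [false], which matches the absence of loops. *)
- by rewrite adj_irrefl nth_default ?rn.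
- by rewrite lj rE.
- by rewrite li ltn_eqF // rE // adj_sym.
by rewrite li lj !ltn_eqF // Ms.
Qed.

Lemma HH_failure_forbidden (G : sgraph) (v w u : G) :
  max_degree v -> adj v w -> u != v -> ~~ adj v u -> deg w < deg u ->
  exists H, forbidden_graphs H /\ exists f : H -> G, embedding f.
Proof.
move=> vmax vw uv vu wu; have sU : uniq [:: v; w; u].
  rewrite /= !inE (eq_sym v u) (negPf uv) orbF andbT; apply/andP; split.
    by apply: contraTneq vw => <-; rewrite adj_irrefl.
  by apply: contraTneq vw => ->.
have := @refutesP G v w u 4 [::] (seed (adj w u)) vmax wu sU; apply.
- by do 2!apply: extend_sym.
- move=> i j; rewrite !inE; move: i j => [|[|[|i]]] [|[|[|j]]] // _ _;
    by rewrite /= ?(adj_sym w v) ?(adj_sym u) ?adj_irrefl ?vw ?(negPf vu).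
exact: seed_refuted.
Qed.

Theorem theorem1 (G : sgraph) : strong_HH G <-> Forb forbidden_graphs G.
Proof.
split=> [sG H /obstruction_forbidden[i ilt <-] A iso | noF A v vmax].
  have [v vmax []] := HH_violatedP (obstruction_uniq i) (@mem_obstruction i)
                                   (obstruction_HH_violated ilt).
  exact: strong_HH_isomorphic sG iso vmax.
split=> // w u vw uv vu; rewrite leqNgt; apply/negP=> wu.
have [H [FH [f fE]]] := HH_failure_forbidden vmax vw uv vu wu.
(* An obstruction inside the subgraph induced by [A] is also one in [G]. *)
have [B] := embedding_isomorphic (embedding_comp fE (@embedding_induced _ _)).
exact: noF.
Qed.
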